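(* Let $\ell\ge1$ and let $G=A_\ell$ or $G=C_\ell$. Suppose the sequences $A=\{A_{(\mathbf{N};G)}\}_{\mathbf{N}\in\mathbb{Z}_{\ge0}^{\ell}}$ and $B=\{B_{(\mathbf{N};G)}\}_{\mathbf{N}\in\mathbb{Z}_{\ge0}^{\ell}}$ form a $G$-Bailey Pair. Let $A'=\{A'_{(\mathbf{N};G)}\}$ and $B'=\{B'_{(\mathbf{N};G)}\}$ be the sequences constructed from $A$ and $B$ by the formulas in the context (with parameters $\rho,\sigma$ if $G=A_\ell$ and $\alpha,\beta$ if $G=C_\ell$). Then $A'$ and $B'$ also form a $G$-Bailey Pair.
   Context: Let $q$ be a complex number with $0<|q|<1$. Put $(\alpha)_\infty=\prod_{k\ge0}(1-\alpha q^k)$ and, for every integer $n$, $(\alpha)_n=(\alpha)_\infty/(\alpha q^n)_\infty$; i.e. $(\alpha)_n=\prod_{k=0}^{n-1}(1-\alpha q^k)$ for $n\ge0$ and $(\alpha)_{-n}=\prod_{k=1}^{n}(1-\alpha q^{-k})^{-1}$ for $n>0$. In particular $1/(q)_n=0$ for $n<0$. Vectors $\mathbf{i},\mathbf{j},\mathbf{y},\mathbf{N}$ have length $\ell$ with nonnegative integer components; write $|\mathbf{N}|=N_1+\cdots+N_\ell$. Let $a,x_1,\dots,x_\ell$ be indeterminates ($a$ only used for $A_\ell$), and let $\rho,\sigma$ (for $A_\ell$) and $\alpha,\beta$ (for $C_\ell$) be further nonzero parameters, such that none of the denominators below vanishes. Matrices: $$M(\mathbf{i};\mathbf{j};A_\ell)=\prod_{r,s=1}^{\ell}\left(q\tfrac{x_r}{x_s}q^{j_r-j_s}\right)_{i_r-j_r}^{-1}\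 \prod_{k=1}^{\ell}\left(aq\tfrac{x_k}{x_\ell}\right)_{i_k+|\mathbf{j}|}^{-1},$$ $$M(\mathbf{i};\mathbf{j};C_\ell)=\prod_{r,s=1}^{\ell}\left[\left(q\tfrac{x_r}{x_s}q^{j_r-j_s}\right)_{i_r-j_r}^{-1}\left(q x_rx_sq^{j_r+j_s}\right)_{i_r-j_r}^{-1}\right].$$ $G$-Bailey Pair: sequences $A=\{A_{(\mathbf{y};G)}\}$ and $B=\{B_{(\mathbf{y};G)}\}$ indexed by $\mathbb{Z}_{\ge0}^{\ell}$ form a $G$-Bailey Pair if for all $\mathbf{N}\in\mathbb{Z}_{\ge0}^{\ell}$ $$B_{(\mathbf{N};G)}=\sum_{\substack{0\le y_k\le N_k\\ k=1,\dots,\ell}}M(\mathbf{N};\mathbf{y};G)\,A_{(\mathbf{y};G)}.$$ Sequences $A',B'$ for $G=A_\ell$: $$A'_{(\mathbf{N};A_\ell)}=\prod_{k=1}^{\ell}\left(\tfrac{aq}{\rho}\tfrac{x_k}{x_\ell}\right)_{N_k}^{-1}\prod_{k=1}^{\ell}\left(\sigma\tfrac{x_k}{x_\ell}\right)_{N_k}\ \frac{(\rho)_{|\mathbf{N}|}}{(aq/\sigma)_{|\mathbf{N}|}}\,(aq/\rho\sigma)^{|\mathbf{N}|}\,A_{(\mathbf{N};A_\ell)},$$ $$B'_{(\mathbf{N};A_\ell)}=\sum_{\substack{0\le y_k\le N_k\\ k=1,\dots,\ell}}\Biggl\{\prod_{k=1}^{\ell}\left[\left(\sigma\tfrac{x_k}{x_\ell}\right)_{y_k}\left(\tfrac{aq}{\rho}\tfrac{x_k}{x_\ell}\right)_{N_k}^{-1}\right]\prod_{r,s=1}^{\ell}\left(q\tfrac{x_r}{x_s}q^{y_r-y_s}\right)_{N_r-y_r}^{-1}\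 \frac{(aq/\rho\sigma)_{|\mathbf{N}|-|\mathbf{y}|}\,(\rho)_{|\mathbf{y}|}}{(aq/\sigma)_{|\mathbf{N}|}}\,(aq/\rho\sigma)^{|\mathbf{y}|}\,B_{(\mathbf{y};A_\ell)}\Biggr\},$$ where $aq/\rho\sigma$ means $aq/(\rho\sigma)$. Sequences $A',B'$ for $G=C_\ell$: $$A'_{(\mathbf{N};C_\ell)}=\prod_{k=1}^{\ell}\left[\frac{(\alpha x_k)_{N_k}\,(qx_k\beta^{-1})_{N_k}}{(\beta x_k)_{N_k}\,(qx_k\alpha^{-1})_{N_k}}\right]\left(\frac{\beta}{\alpha}\right)^{|\mathbf{N}|}A_{(\mathbf{N};C_\ell)},$$ $$B'_{(\mathbf{N};C_\ell)}=\sum_{\substack{0\le y_k\le N_k\\ k=1,\dots,\ell}}\Biggl\{\prod_{k=1}^{\ell}\left[\frac{(\alpha x_k)_{y_k}\,(qx_k\beta^{-1})_{y_k}}{(\beta x_k)_{N_k}\,(qx_k\alpha^{-1})_{N_k}}\right]\prod_{r,s=1}^{\ell}\left(q\tfrac{x_r}{x_s}q^{y_r-y_s}\right)_{N_r-y_r}^{-1}\prod_{1\le r<s\le\ell}\left[\left(qx_rx_sq^{y_r+y_s}\right)_{N_s-y_s}^{-1}\left(qx_rx_sq^{N_s+y_r}\right)_{N_r-y_r}^{-1}\right]\times\left(\tfrac{\beta}{\alpha}\right)_{|\mathbf{N}|-|\mathbf{y}|}\left(\frac{\beta}{\alpha}\right)^{|\mathbf{y}|}B_{(\mathbf{y};C_\ell)}\Biggr\},$$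 where $\left(\tfrac{\beta}{\alpha}\right)_{|\mathbf{N}|-|\mathbf{y}|}$ is the $q$-shifted factorial and $\left(\tfrac{\beta}{\alpha}\right)^{|\mathbf{y}|}$ an ordinary power. *)

(* Defs.v *)
From HB Require Import structures.
From mathcomp Require Import all_boot all_order all_algebra.
From mathcomp Require Import reals complex.

Set Implicit Arguments.
Unset Strict Implicit.
Unset Printing Implicit Defensive.

Import Order.TTheory GRing.Theory Num.Theory.
Local Open Scope ring_scope.

Definition vec (l : nat) := {ffun 'I_l -> nat}.

Definition vsize (l : nat) (N : vec l) : nat := (\sum_k N k)%N.

(* The finite box of all y with 0 <= y_k <= N_k for every k. *)
Definition box (l : nat) (N : vec l) := {dffun forall k : 'I_l, 'I_(N k).+1}.

Definition box_vec (l : nat) (N : vec l) (y : box N) : vec l :=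
  [ffun k => nat_of_ord (y k)].

(* The q-shifted factorial (c)_n; Negz m is the integer - (m + 1).
   Since 0^-1 = 0, also ((q)_n)^-1 = 0 for n < 0. *)
Definition qpoch (F : fieldType) (q c : F) (n : int) : F :=
  match n with
  | Posz m => \prod_(0 <= k < m) (1 - c * q ^+ k)
  | Negz m => \prod_(1 <= k < m.+2) (1 - c * q ^- k)^-1
  end.

Section Root_systems.

Variables (F : fieldType) (q : F).

Local Notation poch := (qpoch q).

Definition bailey_pair (l : nat) (M : vec l -> vec l -> F)
    (A B : vec l -> F) : Prop :=
  forall N, B N = \sum_(y : box N) M N (box_vec y) * A (box_vec y).

(* For A_l the rank is l.+1, so that ord_max is the last index. *)
Definition M_A (l : nat) (a : F) (x : 'I_l.+1 -> F) (i j : vec l.+1) : F :=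
  (\prod_r \prod_s
     (poch (q * (x r / x s) * q ^ ((j r)%:Z - (j s)%:Z))
           ((i r)%:Z - (j r)%:Z))^-1)
  * \prod_k (poch (a * q * (x k / x ord_max)) (i k + vsize j)%N)^-1.

Definition M_C (l : nat) (x : 'I_l -> F) (i j : vec l) : F :=
  \prod_r \prod_s
    ((poch (q * (x r / x s) * q ^ ((j r)%:Z - (j s)%:Z))
           ((i r)%:Z - (j r)%:Z))^-1
     * (poch (q * x r * x s * q ^+ (j r + j s))
             ((i r)%:Z - (j r)%:Z))^-1).

Definition A'_A (l : nat) (a rho sigma : F) (x : 'I_l.+1 -> F)
    (A : vec l.+1 -> F) (N : vec l.+1) : F :=
  (\prod_k (poch (a * q / rho * (x k / x ord_max)) (N k))^-1)
  * (\prod_k poch (sigma * (x k / x ord_max)) (N k))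
  * (poch rho (vsize N) / poch (a * q / sigma) (vsize N))
  * (a * q / (rho * sigma)) ^+ vsize N
  * A N.

Definition B'_A (l : nat) (a rho sigma : F) (x : 'I_l.+1 -> F)
    (B : vec l.+1 -> F) (N : vec l.+1) : F :=
  \sum_(b : box N)
    let y := box_vec b in
    (\prod_k (poch (sigma * (x k / x ord_max)) (y k)
              * (poch (a * q / rho * (x k / x ord_max)) (N k))^-1))
    * (\prod_r \prod_s
         (poch (q * (x r / x s) * q ^ ((y r)%:Z - (y s)%:Z))
               ((N r)%:Z - (y r)%:Z))^-1)
    * (poch (a * q / (rho * sigma)) ((vsize N)%:Z - (vsize y)%:Z)
       * poch rho (vsize y) / poch (a * q / sigma) (vsize N))
    * (a * q / (rho * sigma)) ^+ vsize y
    * B y.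

Definition A'_C (l : nat) (alpha beta : F) (x : 'I_l -> F)
    (A : vec l -> F) (N : vec l) : F :=
  (\prod_k ((poch (alpha * x k) (N k) * poch (q * x k * beta^-1) (N k))
            / (poch (beta * x k) (N k) * poch (q * x k * alpha^-1) (N k))))
  * (beta / alpha) ^+ vsize N
  * A N.

Definition B'_C (l : nat) (alpha beta : F) (x : 'I_l -> F)
    (B : vec l -> F) (N : vec l) : F :=
  \sum_(b : box N)
    let y := box_vec b in
    (\prod_k ((poch (alpha * x k) (y k) * poch (q * x k * beta^-1) (y k))
              / (poch (beta * x k) (N k) * poch (q * x k * alpha^-1) (N k))))
    * (\prod_r \prod_s
         (poch (q * (x r / x s) * q ^ ((y r)%:Z - (y s)%:Z))
               ((N r)%:Z - (y r)%:Z))^-1)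
    * (\prod_(r < l) \prod_(s < l | (r < s)%N)
         ((poch (q * x r * x s * q ^+ (y r + y s))
                ((N s)%:Z - (y s)%:Z))^-1
          * (poch (q * x r * x s * q ^+ (N s + y r))
                  ((N r)%:Z - (y r)%:Z))^-1))
    * poch (beta / alpha) ((vsize N)%:Z - (vsize y)%:Z)
    * (beta / alpha) ^+ vsize y
    * B y.

(* The denominators of M_A (only j <= i occurs in the sums), A'_A and B'_A. *)
Definition denominators_A (l : nat) (a rho sigma : F)
    (x : 'I_l.+1 -> F) : Prop :=
  [/\ forall k, x k != 0,
      forall i j : vec l.+1, (forall k, (j k <= i k)%N) -> forall r s,
        poch (q * (x r / x s) * q ^ ((j r)%:Z - (j s)%:Z))
             ((i r)%:Z - (j r)%:Z) != 0,
      forall i j : vec l.+1, (forall k, (j k <= i k)%N) -> forall k,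
        poch (a * q * (x k / x ord_max)) (i k + vsize j)%N != 0,
      forall (N : vec l.+1) k,
        poch (a * q / rho * (x k / x ord_max)) (N k) != 0
    & forall N : vec l.+1, poch (a * q / sigma) (vsize N) != 0].

(* The denominators of M_C (only j <= i occurs in the sums), A'_C and B'_C.
   Those of B'_C indexed by r < s are instances of the third condition: take
   (i_s, j_s, j_r) = (N_s, y_s, y_r), and (i_r, j_r, j_s) = (N_r, y_r, N_s). *)
Definition denominators_C (l : nat) (alpha beta : F) (x : 'I_l -> F) : Prop :=
  [/\ forall k, x k != 0,
      forall i j : vec l, (forall k, (j k <= i k)%N) -> forall r s,
        poch (q * (x r / x s) * q ^ ((j r)%:Z - (j s)%:Z))
             ((i r)%:Z - (j r)%:Z) != 0,
      forall i j : vec l, (forall k, (j k <= i k)%N) -> forall r s,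
        poch (q * x r * x s * q ^+ (j r + j s))
             ((i r)%:Z - (j r)%:Z) != 0,
      forall (N : vec l) k, poch (beta * x k) (N k) != 0
    & forall (N : vec l) k, poch (q * x k * alpha^-1) (N k) != 0].

End Root_systems.

(* Main.v *)
Require Import Defs.
From HB Require Import structures.
From mathcomp Require Import all_boot all_order all_algebra.
From mathcomp Require Import reals complex.
From mathcomp Require Import ring zify.

Import Order.TTheory GRing.Theory Num.Theory.
Local Open Scope ring_scope.
Set Implicit Arguments.
Unset Strict Implicit.
Unset Printing Implicit Defensive.

(* Composing the two kernels reduces the claim to a summation formula
     sum_(j <= y <= N) K(N, y) M(y, j) = M(N, j) c(j),
   where c is the factor relating A' to A. Up to factors independent of y, the
   summand is, with t = 1/sigma (resp. 1/alpha) and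
   Q_y(t) = prod_s prod_(j_s <= i < y_s) (t - x_s q^i),
     Q_y(t) prod_r Q_y(x_r q^(N_r)) (b t)_(|N| - |y|) b^|y| h(y),
   h independent of N and t. Both sides are polynomials in t of degree at most
   |N| - |j|. They agree at t = 1/b, where only y = N contributes, and at
   t = x_k q^m for j_k <= m < N_k: there, exchanging the roles of t and
   x_k q^(N_k) gives the formula with N_k replaced by m, so induction on |N|
   applies. If b = 0 (that is, a = 0) only y = j contributes. *)

(** * Functions given by polynomials of bounded degree *)

Section PolynomialFunctions.

Variable F : fieldType.

Definition polyfun (n : nat) (f : F -> F) : Prop :=
  exists2 p : {poly F}, (size p <= n.+1)%N & forall t, p.[t] = f t.

Lemma polyfun_ext n f g : f =1 g -> polyfun n f -> polyfun n g.
Proof. by move=> fg [p sp pf]; exists p => // t; rewrite pf. Qed.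

Lemma polyfun_cst c : polyfun 0 (fun=> c).
Proof. by exists c%:P => [|t]; rewrite ?size_polyC_leq1 ?hornerC. Qed.

Lemma polyfun_lin a b : polyfun 1 (fun t => a + b * t).
Proof.
exists (a%:P + b *: 'X) => [|t]; last by rewrite !hornerE.
rewrite (leq_trans (size_polyD _ _)) // geq_max.
rewrite (leq_trans (size_polyC_leq1 _)) //.
by rewrite (leq_trans (size_scale_leq _ _)) // size_polyX.
Qed.

Lemma polyfunM m n f g :
  polyfun m f -> polyfun n g -> polyfun (m + n) (fun t => f t * g t).
Proof.
move=> [p sp pf] [r sr rg]; exists (p * r) => [|t]; last by rewrite hornerM pf rg.
rewrite (leq_trans (size_polyMleq _ _)) //.
by case: (size p) (size r) sp sr => [|a] [|b] //=; lia.
Qed.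

Lemma polyfun_prod (I : Type) (s : seq I) (P : pred I) (d : I -> nat)
    (f : I -> F -> F) :
  (forall i, polyfun (d i) (f i)) ->
  polyfun (\sum_(i <- s | P i) d i) (fun t => \prod_(i <- s | P i) f i t).
Proof.
move=> df; elim: s => [|i s IHs].
  rewrite big_nil; apply: polyfun_ext (polyfun_cst 1) => t.
  by rewrite big_nil.
rewrite big_cons; case: ifP => Pi.
  by apply: polyfun_ext (polyfunM (df i) IHs) => t; rewrite big_cons Pi.
by apply: polyfun_ext IHs => t; rewrite big_cons Pi.
Qed.

Lemma polyfun_prod_nat m n (f : nat -> F -> F) :
  (forall i, polyfun 1 (f i)) ->
  polyfun (n - m) (fun t => \prod_(m <= i < n) f i t).
Proof.
move=> f1; rewrite -[X in polyfun X]muln1 -sum_nat_const_nat.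
exact: polyfun_prod.
Qed.

Lemma polyfun_sum n (I : Type) (s : seq I) (P : pred I) (f : I -> F -> F) :
  (forall i, P i -> polyfun n (f i)) ->
  polyfun n (fun t => \sum_(i <- s | P i) f i t).
Proof.
move=> df; elim: s => [|i s [p sp pf]].
  exists 0 => [|t]; first by rewrite size_poly0.
  by rewrite big_nil horner0.
case Pi: (P i); last by exists p => // t; rewrite big_cons Pi.
have [r sr rf] := df i Pi; exists (r + p) => [|t].
  by rewrite (leq_trans (size_polyD _ _)) // geq_max sr.
by rewrite big_cons Pi hornerD rf pf.
Qed.

(** The difference of the two polynomials has size at most [n.+1] and more than [n] distinct roots,
    so it is zero. *)
Lemma polyfun_uniq n f g (s : seq F) :
  polyfun n f -> polyfun n g -> uniq s -> (n < size s)%N ->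
  {in s, f =1 g} -> f =1 g.
Proof.
move=> [p sp pf] [r sr rg] us ns fg t.
suff /eqP e : p == r by rewrite -pf -rg e.
rewrite -subr_eq0; apply/contraLR: ns => d0; rewrite -leqNgt.
suff /leq_trans sn : (size s < size (p - r)%R)%N.
  by rewrite -ltnS sn // (leq_trans (size_polyD _ _)) // size_polyN geq_max sp.
apply: max_poly_roots => //; apply/allP => u us'.
by rewrite /root hornerD hornerN pf rg fg // subrr.
Qed.

End PolynomialFunctions.

(** * Sums over boxes of nonnegative integer vectors *)

Section Boxes.

Variable l : nat.
Implicit Types N y j : vec l.

Definition vle y N := [forall k, y k <= N k]%N.

Lemma vleP y N : reflect (forall k, (y k <= N k)%N) (vle y N).
Proof. exact: forallP. Qed.

Lemma vle_trans N y j : vle j y -> vle y N -> vle j N.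
Proof. by move=> /vleP a /vleP b; apply/vleP => k; apply: leq_trans (b k). Qed.

Lemma vle_vsize y N : vle y N -> (vsize y <= vsize N)%N.
Proof. by move=> /vleP yN; apply: leq_sum. Qed.

Lemma leq_vsize N k : (N k <= vsize N)%N.
Proof. by rewrite /vsize (bigD1 k) //= leq_addr. Qed.

Lemma vsizeB y N : vle y N -> (vsize N - vsize y = \sum_k (N k - y k))%N.
Proof. by move=> /vleP yN; rewrite sumnB. Qed.

Lemma vle_size_eq y N : vle y N -> vsize N = vsize y -> y = N.
Proof.
move=> yN e; have /vleP le := yN.
have : (\sum_k (N k - y k) == 0)%N by rewrite -vsizeB // e subnn.
rewrite sum_nat_eq0 => /forallP z; apply/ffunP => k.
by apply/eqP; rewrite eqn_leq le -subn_eq0 (implyP (z k)).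
Qed.

Definition upd N (k : 'I_l) (m : nat) : vec l :=
  [ffun s => if s == k then m else N s].

Lemma upd_same N k m : upd N k m k = m.
Proof. by rewrite ffunE eqxx. Qed.

Lemma upd_other N k m s : s != k -> upd N k m s = N s.
Proof. by rewrite ffunE => /negPf ->. Qed.

Lemma vsize_upd N k m : (vsize (upd N k m) + N k = vsize N + m)%N.
Proof.
rewrite /vsize (bigD1 k) //= upd_same [in RHS](bigD1 k) //=.
rewrite (eq_bigr N) => [|s sk]; last exact: upd_other.
by rewrite addnAC [(_ + m)%N]addnC addnA.
Qed.

Lemma vle_upd N k m y :
  vle y N -> (y k <= m)%N -> vle y (upd N k m).
Proof.
move=> /vleP yN ym; apply/vleP => s; rewrite ffunE.
by case: eqP => [->|].
Qed.

Lemma upd_vle N k m : (m <= N k)%N -> vle (upd N k m) N.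
Proof. by move=> mN; apply/vleP => s; rewrite ffunE; case: eqP => [->|]. Qed.

(* All boxes below [0, D]^l embed in this single finite type. *)
Definition cube_vec D (y : {ffun 'I_l -> 'I_D.+1}) : vec l :=
  [ffun k => nat_of_ord (y k)].

(** The type [box N] varies with [N], which prevents exchanging nested box sums; over a fixed cube
    the bounds become predicates. The bound by [D] keeps [inord] from taking its default value. *)
Lemma sum_box (F : fieldType) D N (f : vec l -> F) :
  (forall k, N k <= D)%N ->
  \sum_(y : box N) f (box_vec y) =
  \sum_(y : {ffun 'I_l -> 'I_D.+1} | vle (cube_vec y) N) f (cube_vec y).
Proof.
move=> ND.
pose g (y : box N) : {ffun 'I_l -> 'I_D.+1} := [ffun k => inord (y k)].
pose g' (y : {ffun 'I_l -> 'I_D.+1}) : box N := [ffun k => inord (y k)].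
have gE (y : box N) : cube_vec (g y) = box_vec y.
  apply/ffunP => k; rewrite !ffunE inordK // ltnS.
  by rewrite (leq_trans _ (ND k)) // -ltnS.
have g'K (y : {ffun _}) : vle (cube_vec y) N -> g (g' y) = y.
  move=> /vleP yN; apply/ffunP => k; rewrite !ffunE; apply: val_inj.
  by have := yN k; rewrite !ffunE => yk; rewrite /= !inordK // ltnS.
have gK (y : box N) : g' (g y) = y.
  apply/ffunP => k; apply: val_inj; have := congr1 (fun v : vec l => v k) (gE y).
  by rewrite !ffunE => e; rewrite /= inordK ?e //.
rewrite (reindex_onto g g') => [|y /g'K //].
apply: eq_big => [y|y _]; last by rewrite gE.
rewrite gE gK eqxx andbT; apply/esym/vleP => k.
by rewrite ffunE -ltnS.
Qed.

(** The first hypothesis is the matrix identity K M = M diag(c) for triangular matrices. It remains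
    to substitute the relation for [B] and to exchange the sums over y and j. *)
Lemma bailey_pair_lift (F : fieldType) (M K : vec l -> vec l -> F) (c : vec l -> F)
    (A B : vec l -> F) :
  (forall N j, vle j N ->
     \sum_(y : {ffun 'I_l -> 'I_(vsize N).+1}
          | vle j (cube_vec y) && vle (cube_vec y) N)
        K N (cube_vec y) * M (cube_vec y) j = M N j * c j) ->
  bailey_pair M A B ->
  bailey_pair M (fun N => c N * A N)
    (fun N => \sum_(y : box N) K N (box_vec y) * B (box_vec y)).
Proof.
move=> KM AB N; have ND := leq_vsize N.
rewrite (sum_box (fun y => K N y * B y) ND).
rewrite (sum_box (fun y => M N y * (c y * A y)) ND).
under eq_bigr => y yN.
  have yD k : (cube_vec y k <= vsize N)%N.
    by rewrite (leq_trans _ (ND k)) //; move/vleP: yN.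
  rewrite AB (sum_box (fun j => M (cube_vec y) j * A j) yD).
  rewrite big_distrr /=; over.
rewrite (exchange_big_dep (fun j : {ffun _} => vle (cube_vec j) N)) /=; last first.
  by move=> y j yN jy; apply: vle_trans yN.
apply: eq_bigr => j jN; rewrite mulrA -KM // big_distrl /=.
by apply: eq_big => y; [rewrite andbC | rewrite mulrA].
Qed.

End Boxes.

(** * A summation of q-Saalschuetz type, by interpolation *)

Section Summation.

Variables (F : fieldType) (q : F).

(** For m <= n this is (c q^m)_(n-m). Recording both ends turns the splitting and cancelling of
    shifted factorials into concatenation. *)
Definition qseg (c : F) (m n : nat) : F := \prod_(m <= i < n) (1 - c * q ^+ i).

Lemma qseg_cat c m n p : (m <= n <= p)%N -> qseg c m n * qseg c n p = qseg c m p.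
Proof. by move=> /andP[mn np]; rewrite /qseg (big_cat_nat mn np). Qed.

Lemma qseg_shift c k m n : qseg (c * q ^+ k) m n = qseg c (m + k) (n + k).
Proof.
rewrite /qseg big_addn addnK; apply: eq_big_nat => i _.
by rewrite exprD mulrAC mulrA.
Qed.

Lemma qseg_neq0 c m n : (forall i, 1 - c * q ^+ i != 0) -> qseg c m n != 0.
Proof.
by move=> c0; rewrite prodf_seq_neq0; apply/allP => i _; apply: c0.
Qed.

Lemma qsegnn c n : qseg c n n = 1.
Proof. by rewrite /qseg big_geq. Qed.

Lemma qseg_eq1 c m n : c = 0 -> qseg c m n = 1.
Proof. by move=> ->; rewrite /qseg big1 // => i _; rewrite mul0r subr0. Qed.

(* Bailey's parameters are t = 1/sigma, b = aq/rho for A_l (up to factors x_l)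
   and t = 1/alpha, b = beta for C_l. *)
Variables (l : nat) (x : 'I_l -> F) (b : F) (j : vec l) (D : nat).

(** Q_y(t) of the overview. At t = 1/sigma it is, up to a power of sigma, the part of the product of
    the (sigma x_k)_(y_k) beyond the (sigma x_k)_(j_k). *)
Definition nodes (y : vec l) (t : F) : F :=
  \prod_s \prod_(j s <= i < y s) (t - x s * q ^+ i).

(** The weight [h] is left arbitrary so that A_l and C_l share the interpolation argument. *)
Definition saal_sum (h : vec l -> F) (N : vec l) (t : F) : F :=
  \sum_(y : {ffun 'I_l -> 'I_D.+1} | vle j (cube_vec y) && vle (cube_vec y) N)
    let y := cube_vec y in
    nodes y t * (\prod_r nodes y (x r * q ^+ N r))
    * qseg (b * t) 0 (vsize N - vsize y) * b ^+ (vsize y - vsize j) * h y.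

Lemma nodes_root (y : vec l) s m : (j s <= m < y s)%N -> nodes y (x s * q ^+ m) = 0.
Proof.
move=> jmy; apply/eqP; rewrite prodf_seq_eq0; apply/hasP; exists s.
  exact: mem_index_enum.
rewrite /= prodf_seq_eq0; apply/hasP; exists m; first by rewrite mem_index_iota.
by rewrite /= subrr.
Qed.

Lemma polyfun_nodes y : vle j y -> polyfun (vsize y - vsize j) (nodes y).
Proof.
move=> jy; rewrite vsizeB //; apply: polyfun_prod => s.
apply: polyfun_prod_nat => i.
apply: polyfun_ext (polyfun_lin (- (x s * q ^+ i)) 1) => t.
by rewrite mul1r addrC.
Qed.

Lemma polyfun_qseg c m n : polyfun (n - m) (fun t => qseg (c * t) m n).
Proof.
apply: polyfun_prod_nat => i; apply: polyfun_ext (polyfun_lin 1 (- (c * q ^+ i))) => t.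
by rewrite mulNr mulrAC.
Qed.

Lemma polyfunZl n c (f : F -> F) : polyfun n f -> polyfun n (fun t => c * f t).
Proof. by move=> /(polyfunM (polyfun_cst c)). Qed.

Lemma polyfun_saal_sum h N : polyfun (vsize N - vsize j) (saal_sum h N).
Proof.
apply: polyfun_sum => y /andP[jy yN]; set y' := cube_vec y in jy yN *.
(* The degrees |y| - |j| of [nodes] and |N| - |y| of [qseg] add up to a bound independent of y. *)
have e : (vsize N - vsize j = (vsize y' - vsize j) + (vsize N - vsize y' - 0))%N.
  by move: (vle_vsize jy) (vle_vsize yN); lia.
rewrite e; apply: polyfun_ext (polyfunZl
  ((\prod_r nodes y' (x r * q ^+ N r)) * b ^+ (vsize y' - vsize j) * h y')
  (polyfunM (polyfun_nodes jy) (polyfun_qseg b 0 (vsize N - vsize y')))) => t.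
by rewrite /=; ring.
Qed.

(* Only the factor qseg (b * t) breaks the symmetry of the summand between t
   and x_k q^(N_k); the terms with m < y_k vanish. *)
Lemma saal_sum_swap h (N : vec l) k m : vle j N -> (j k <= m < N k)%N ->
  saal_sum h N (x k * q ^+ m) =
  qseg (b * x k) m (N k) * saal_sum h (upd N k m) (x k * q ^+ N k).
Proof.
move=> jN /andP[jm mN].
rewrite /saal_sum (bigID (fun y : {ffun _} => vle (cube_vec y) (upd N k m))) /=.
rewrite [X in _ + X]big1 ?addr0 => [|y /andP[/andP[jy yN] yN']]; last first.
  rewrite nodes_root ?mul0r // jm ltnNge.
  by apply: contra yN' => ym; apply: vle_upd.
rewrite big_distrr /=; apply: eq_big => [y|y /andP[/andP[jy yN] yN']].
  rewrite -andbA; case: (vle j _) => //=; apply: andb_idl => yN'.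
  by apply: vle_trans (upd_vle (ltnW mN)).
set y' := cube_vec y in jy yN yN' *.
(* Once r = k is isolated on both sides, the values of [nodes] at x_k q^m and x_k q^(N_k) merely
   trade places. *)
rewrite (bigD1 k) //= [\prod_r nodes _ (x r * q ^+ upd _ _ _ r)](bigD1 k) //= upd_same.
under [in RHS]eq_bigr => s sk do rewrite upd_other //.
rewrite -!mulrA !mulrA !qseg_shift !add0n.
have e := vsize_upd N k m; have le := vle_vsize yN'.
(* After the shifts both segments of base b x_k end at the same index, so they differ by the segment
   from m to N_k. *)
have -> : (vsize (upd N k m) - vsize y' + N k = vsize N - vsize y' + m)%N.
  by move: (vle_vsize yN); lia.
rewrite -(@qseg_cat _ m (N k) (vsize N - vsize y' + m)); first by ring.
by rewrite (ltnW mN) /=; lia.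
Qed.

Hypothesis x_inj : forall r s m n, x r * q ^+ m = x s * q ^+ n -> r = s /\ m = n.

Lemma nodes_diag_neq0 (y : vec l) : \prod_r nodes y (x r * q ^+ y r) != 0.
Proof.
rewrite prodf_seq_neq0; apply/allP => r _ /=.
rewrite prodf_seq_neq0; apply/allP => s _ /=.
rewrite prodf_seq_neq0; apply/allP => i; rewrite mem_index_iota => /andP[_ iy].
rewrite /= subr_eq0; apply/eqP => /x_inj[rs e].
by move: iy; rewrite -e rs ltnn.
Qed.

Hypothesis b_nz : b != 0.
Hypothesis b_pole : forall k n, 1 - b * x k * q ^+ n != 0.

(** Each of the |y| - |j| linear factors absorbs one b, since b (1/b - x_s q^i) = 1 - b x_s q^i. *)
Lemma nodes_invb y : vle j y ->
  nodes y b^-1 * b ^+ (vsize y - vsize j) = \prod_k qseg (b * x k) (j k) (y k).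
Proof.
move=> jy; rewrite vsizeB // -prodrXr -big_split; apply: eq_bigr => s _ /=.
rewrite -prodr_const_nat -big_split; apply: eq_bigr => i _ /=.
by rewrite mulrBl mulVf //; congr (1 - _); ring.
Qed.

(* Interpolation at b^-1, where only y = N survives, and at the points
   x_k q^m with j_k <= m < N_k, where the swap lowers N. *)
Lemma saal_sum_eval h (R : vec l -> F -> F) :
  (forall N, vle j N -> polyfun (vsize N - vsize j) (R N)) ->
  (forall N, vle j N -> R N b^-1 =
     (\prod_k qseg (b * x k) (j k) (N k)) * (\prod_r nodes N (x r * q ^+ N r)) * h N) ->
  (forall N k m, vle j N -> (j k <= m < N k)%N ->
     R N (x k * q ^+ m) = qseg (b * x k) m (N k) * R (upd N k m) (x k * q ^+ N k)) ->
  forall N t, vle j N -> (forall k, N k <= D)%N -> saal_sum h N t = R N t.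
Proof.
move=> Rpoly Rinv Rswap N t; have [n] := ubnP (vsize N).
elim: n => // n IHn in N t * => Nn jN ND.
(* [T] indexes the points x_k q^m with j_k <= m < N_k. There are |N| - |j| of them, so adding 1/b
   gives one point more than the degree bound. *)
pose T : finType := {k : 'I_l & 'I_(N k - j k)}.
pose pt (u : T) := x (tag u) * q ^+ (j (tag u) + tagged u).
pose s := b^-1 :: [seq pt u | u <- enum {: T}].
apply: (@polyfun_uniq _ (vsize N - vsize j) _ _ s).
- exact: polyfun_saal_sum.
- exact: Rpoly.
- rewrite /= map_inj_uniq ?enum_uniq ?andbT => [|[k m] [k' m'] /x_inj /= [e]].
    apply/mapP => -[[k m] _ e]; have /eqP := b_pole k (j k + m).
    by apply; rewrite -mulrA [x k * _](esym e) mulfV // subrr.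
  by case: k' / e m' => m' /addnI e; congr existT; apply: val_inj.
- rewrite /= size_map -cardE card_tagged sumnE big_map big_enum /=.
  by rewrite ltnS vsizeB //; apply: eq_leq; apply: eq_bigr => k _; rewrite card_ord.
move=> u; rewrite inE => /orP[/eqP->|/mapP[[k m] _ ->]]; last first.
  have mN : (j k <= j k + m < N k)%N by rewrite leq_addr /=; have := ltn_ord m; lia.
  rewrite /pt /= saal_sum_swap // Rswap //; congr (_ * _).
  have /andP[jm mN'] := mN; apply: IHn.
  - by have := vsize_upd N k (j k + m); lia.
  - exact: vle_upd.
  - move=> i; rewrite ffunE; case: eqP => // _.
    by rewrite (leq_trans (ltnW mN')).
rewrite Rinv // /saal_sum.
pose y0 : {ffun 'I_l -> 'I_D.+1} := [ffun k => inord (N k)].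
have y0E : cube_vec y0 = N by apply/ffunP => k; rewrite !ffunE inordK // ltnS.
rewrite (bigD1 y0) /=; last by rewrite y0E jN; apply/vleP.
rewrite y0E subnn qsegnn mulr1 [X in _ + X]big1 ?addr0 => [|y /andP[/andP[jy yN] yy0]].
  by rewrite -[RHS]mulrA -nodes_invb //; ring.
(* At t = 1/b the segment becomes (1)_d with d = |N| - |y|. Its first factor is zero as soon as d >
   0, that is, for y different from N. *)
rewrite mulfV // [qseg _ _ _](_ : _ = 0) ?(mulr0, mul0r) //.
have : (0 < vsize N - vsize (cube_vec y))%N.
  rewrite lt0n subn_eq0; apply: contra yy0 => le.
  have e := vle_size_eq yN; apply/eqP/ffunP => k; apply: val_inj.
  have /e /(congr1 (fun v : vec l => v k)) : vsize N = vsize (cube_vec y).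
    by apply/eqP; rewrite eqn_leq le vle_vsize.
  by rewrite -[in X in _ = X -> _]y0E !ffunE.
by case: (vsize N - _)%N => // d _; rewrite /qseg big_nat_recl // expr0 mul1r subrr mul0r.
Qed.

End Summation.

(** * The kernel common to both types, and the A_l summation *)

Section TypeA.

Variables (F : fieldType) (q : F) (l : nat) (x : 'I_l -> F).

Hypothesis q_nz : q != 0.
Hypothesis x_nz : forall k, x k != 0.
Hypothesis x_inj : forall r s m n, x r * q ^+ m = x s * q ^+ n -> r = s /\ m = n.

Lemma qpoch_qseg c u n : (u <= n)%N ->
  qpoch q (c * q ^+ u) (n%:Z - u%:Z) = qseg q c u n.
Proof.
move=> un; rewrite subzn //= -[RHS]/(qseg q c u n).
by rewrite -[LHS]/(qseg q _ 0 _) qseg_shift add0n subnK.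
Qed.

Lemma qpoch_ratio c u v n : (u <= n)%N ->
  qpoch q (c * q ^ (u%:Z - v%:Z)) (n%:Z - u%:Z) = qseg q (c / q ^+ v) u n.
Proof.
move=> un; rewrite -qpoch_qseg //; congr qpoch.
by rewrite expfzDr // -exprnN -exprnP; ring.
Qed.

(** Induction on v. In the step from v to v + 1 both sides reduce, up to the same power of -w q^v,
    to the product of z q^k - w q^v over u <= k <= n; the separate factor is k = n on the left and k
    = u on the right. *)
Lemma nodes_qseg_exchange (z w : F) i v u n :
  w != 0 -> (i <= v)%N -> (u <= n)%N ->
  (\prod_(i <= e < v) (z * q ^+ n - w * q ^+ e)) * qseg q (q * (z / w) / q ^+ v) u n
  = (\prod_(i <= e < v) (z * q ^+ u - w * q ^+ e)) * qseg q (q * (z / w) / q ^+ i) u n.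
Proof.
move=> w0 iv un; elim: v iv => [|v IHv].
  by rewrite leqn0 => /eqP ->; rewrite !big_geq.
rewrite leq_eqVlt => /orP[/eqP<-|]; first by rewrite !big_geq.
rewrite ltnS => iv; rewrite !big_nat_recr //=.
suff e : (z * q ^+ n - w * q ^+ v) * qseg q (q * (z / w) / q ^+ v.+1) u n
         = (z * q ^+ u - w * q ^+ v) * qseg q (q * (z / w) / q ^+ v) u n.
  by rewrite -mulrA e mulrCA IHv // mulrCA mulrA.
have qv0 : q ^+ v != 0 by rewrite expf_neq0.
elim: n un {IHv} => [|n IHn].
  by rewrite leqn0 => /eqP ->; rewrite !qsegnn.
rewrite leq_eqVlt => /orP[/eqP->|]; first by rewrite !qsegnn.
rewrite ltnS => un; rewrite /qseg !big_nat_recr //= -!/(qseg _ _ _ _).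
rewrite [RHS]mulrA -IHn //.
rewrite [RHS]mulrAC [LHS]mulrC -[LHS]mulrA [LHS]mulrC; congr (_ * _).
by rewrite !exprS; field; rewrite w0 q_nz qv0.
Qed.

(** This product occurs in both matrices M and in both formulas for B'. *)
Definition kerA (i j : vec l) : F :=
  \prod_r \prod_s
     (qpoch q (q * (x r / x s) * q ^ ((j r)%:Z - (j s)%:Z))
           ((i r)%:Z - (j r)%:Z))^-1.

Lemma kerA_neq0 i j : vle j i ->
  \prod_r \prod_s
     qpoch q (q * (x r / x s) * q ^ ((j r)%:Z - (j s)%:Z))
           ((i r)%:Z - (j r)%:Z) != 0.
Proof.
move=> /vleP ji.
rewrite prodf_seq_neq0; apply/allP => r _ /=; rewrite prodf_seq_neq0.
apply/allP => s _ /=; rewrite qpoch_ratio // prodf_seq_neq0.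
apply/allP => e; rewrite mem_index_iota => /andP[je _] /=.
have qn n : q ^+ n != 0 by rewrite expf_neq0.
rewrite subr_eq0 eq_sym -(inj_eq (mulIf (mulf_neq0 (x_nz s) (qn (j s))))).
apply/eqP => h; have /x_inj[rs] : x r * q ^+ e.+1 = x s * q ^+ j s.
  by move: h; rewrite mul1r => <-; rewrite exprS; field; rewrite x_nz qn.
by rewrite -rs => ee; rewrite -ee ltnn in je.
Qed.

(** For each pair r, s, [nodes_qseg_exchange] trades x_r q^(N_r) for x_r q^(y_r) and y_s for j_s in
    the base; then the segments from j_r to y_r and from y_r to N_r join. The dependence on y is
    left in values of Q_y alone. *)
Lemma kerA_mul N y j : vle j y -> vle y N ->
  kerA N y * kerA y j = kerA N j *
    ((\prod_r nodes q x j y (x r * q ^+ N r))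
     / \prod_r nodes q x j y (x r * q ^+ y r)).
Proof.
move=> jy yN; have jN := vle_trans jy yN.
have kE a c : kerA a c = (\prod_r \prod_s
     qpoch q (q * (x r / x s) * q ^ ((c r)%:Z - (c s)%:Z))
           ((a r)%:Z - (c r)%:Z))^-1.
  by rewrite /kerA -prodfV; apply: eq_bigr => r _; rewrite prodfV.
rewrite !kE; have := kerA_neq0 jy; have := kerA_neq0 yN; have := kerA_neq0 jN.
have := nodes_diag_neq0 j x_inj y.
move: jy yN jN => /vleP jy /vleP yN /vleP jN.
set d := \prod_r nodes _ _ _ _ (x r * q ^+ y r).
set n := \prod_r nodes _ _ _ _ (x r * q ^+ N r).
set p1 := \prod_r _; set p2 := \prod_r _; set p3 := \prod_r _.
move=> d0 p10 p20 p30.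
suff e : n * p2 * p3 = d * p1.
  apply: (mulIf d0); apply: (mulIf p10); apply: (mulIf p20); apply: (mulIf p30).
  rewrite -[LHS]mulrA.
  transitivity (d * p1); first by field; rewrite ?p20 ?p30 ?d0 ?p10.
  by rewrite -e; field; rewrite ?p20 ?p30 ?d0 ?p10.
rewrite /n /p2 /p3 /d /p1 /nodes -!big_split /=; apply: eq_bigr => r _.
rewrite -!big_split /=; apply: eq_bigr => s _.
rewrite !qpoch_ratio // nodes_qseg_exchange // -[LHS]mulrA; congr (_ * _).
by rewrite mulrC qseg_cat // jy yN.
Qed.

Variables (a s rho b : F).
Hypothesis a_b : a * q = b * rho.
Hypothesis s_nz : s != 0.
Hypothesis a_pole : forall k n, 1 - a * q * x k * q ^+ n != 0.
Hypothesis b_pole : forall k n, 1 - b * x k * q ^+ n != 0.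

(** The weight h of the overview: factors of K and M that depend on y but not on N or sigma, and the
    diagonal denominator from [kerA_mul]. *)
Definition wtA (j y : vec l) : F :=
  qseg q rho 0 (vsize y) / (\prod_k qseg q (a * q * x k) 0 (y k + vsize j))
  / \prod_r nodes q x j y (x r * q ^+ y r).

Definition valA (j N : vec l) (t : F) : F :=
  qseg q rho 0 (vsize j) * qseg q (a * q * t) (vsize j) (vsize N)
  * \prod_k (qseg q (b * x k) (j k) (N k) / qseg q (a * q * x k) 0 (N k + vsize j)).

Lemma saal_sum_b0 (j : vec l) D h N t : b = 0 -> vle j N -> (forall k, N k <= D)%N ->
  saal_sum q x b j D h N t = h j.
Proof.
move=> b0 jN ND; rewrite /saal_sum.
pose y0 : {ffun 'I_l -> 'I_D.+1} := [ffun k => inord (j k)].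
have y0E : cube_vec y0 = j.
  apply/ffunP => k; rewrite !ffunE inordK // ltnS (leq_trans _ (ND k)) //.
  exact: (vleP _ _ jN).
rewrite (bigD1 y0) /=; last by rewrite y0E jN andbT; apply/vleP.
rewrite y0E subnn expr0 mulr1 qseg_eq1 ?b0 ?mul0r // mulr1.
have nj t' : nodes q x j j t' = 1.
  by rewrite /nodes big1 // => r _; rewrite big_geq.
rewrite nj big1 => [|r _]; last exact: nj.
rewrite !mul1r big1 ?addr0 // => y /andP[/andP[jy yN] yy0].
rewrite expr0n [(_ == 0)%N](_ : _ = false) ?(mulr0, mul0r) //.
apply: contraNF yy0; rewrite subn_eq0 => le; apply/eqP/ffunP => k; apply: val_inj.
have := vle_size_eq jy; rewrite (_ : vsize (cube_vec y) = vsize j).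
  move=> /(_ erefl) /(congr1 (fun v : vec l => v k)).
  by rewrite -[in X in X -> _]y0E !ffunE.
by apply/eqP; rewrite eqn_leq le vle_vsize.
Qed.

(** For nonzero b, [valA] meets the conditions of [saal_sum_eval]: t enters only through a segment
    of length |N| - |j|, the value t = 1/b turns a q t into rho, and the exchange rule is a symmetry
    in m and N_k. *)
Lemma saal_sum_A (j N : vec l) D t : vle j N -> (forall k, N k <= D)%N ->
  saal_sum q x b j D (wtA j) N t = valA j N t.
Proof.
move=> jN ND; have [b0|b_nz] := eqVneq b 0.
  have a0 : a * q = 0 by rewrite a_b b0 mul0r.
  rewrite saal_sum_b0 // /wtA /valA (qseg_eq1 q _ _ (c := a * q * t)) ?a0 ?mul0r //.
  rewrite big1 => [|k _]; last by rewrite qseg_eq1 // mul0r.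
  rewrite big1 => [|r _]; last by rewrite /nodes big1 // => i _; rewrite big_geq.
  rewrite big1 => [|k _]; last by rewrite !qseg_eq1 ?b0 ?mul0r // invr1 mulr1.
  by rewrite invr1 !mulr1.
have a0 k m n : qseg q (a * q * x k) m n != 0 by apply: qseg_neq0.
apply: saal_sum_eval => // {N t jN ND} N.
- move=> jN; rewrite /valA; set c := qseg q rho _ _; set d := \prod_k _.
  apply: polyfun_ext (polyfunZl (c * d)
    (polyfun_qseg q (a * q) (vsize j) (vsize N))) => t.
  by rewrite mulrAC.
- have ab : a * q / b = rho by rewrite a_b mulrAC mulfV // mul1r.
  move=> jN; rewrite /valA /wtA ab qseg_cat ?vle_vsize // big_split /= prodfV.
  have := nodes_diag_neq0 j x_inj N; set d := \prod_r nodes _ _ _ _ _ => d0.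
  set u := \prod_k _; set v := \prod_k _.
  by rewrite -[RHS]mulrA [d * _]mulrC divfK //; ring.
move=> k m jN /andP[jm mN]; rewrite /valA.
rewrite (bigD1 k) //= [in RHS](bigD1 k) //= upd_same.
under [in RHS]eq_bigr => r rk do rewrite upd_other //.
have e := vsize_upd N k m; have le := vle_vsize jN.
have le' : (vsize j <= vsize (upd N k m))%N by rewrite vle_vsize // vle_upd.
rewrite !mulrA !qseg_shift e -(@qseg_cat _ q (b * x k) (j k) m (N k)); last by lia.
set w := \prod_(_ | _) _; set c := a * q * x k.
(* The numerator segments of base c on the two sides both end at |N| + m. Extended down to 0, they
   give quotients symmetric in m and N_k. *)
have e1 : qseg q c 0 (vsize j + m) * qseg q c (vsize j + m) (vsize N + m)
   = qseg q c 0 (vsize N + m) by rewrite qseg_cat //; lia.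
have e2 : qseg q c 0 (vsize j + N k) * qseg q c (vsize j + N k) (vsize N + m)
   = qseg q c 0 (vsize N + m) by rewrite qseg_cat //; lia.
rewrite ![(_ + vsize j)%N]addnC.
have -> : qseg q c (vsize j + m) (vsize N + m) =
  qseg q c 0 (vsize N + m) / qseg q c 0 (vsize j + m)
  by rewrite -e1 mulrAC mulfV ?mul1r //; apply: a0.
have -> : qseg q c (vsize j + N k) (vsize N + m) =
  qseg q c 0 (vsize N + m) / qseg q c 0 (vsize j + N k)
  by rewrite -e2 mulrAC mulfV ?mul1r //; apply: a0.
by ring.
Qed.

Lemma prod_qseg_nodes (u : F) (j y : vec l) : u != 0 -> vle j y ->
  \prod_k qseg q (u * x k) 0 (y k) =
  (\prod_k qseg q (u * x k) 0 (j k)) * (nodes q x j y u^-1 * u ^+ (vsize y - vsize j)).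
Proof.
move=> u0 jy; rewrite nodes_invb // -big_split; apply: eq_bigr => k _ /=.
by rewrite qseg_cat //= (vleP _ _ jy).
Qed.

(** [matA], [baileyA] and [factorA] are M, K and c of the overview, with 1/x_l absorbed into [a],
    [s] and [b]. *)
Definition matA (i j : vec l) : F :=
  kerA i j * \prod_k (qseg q (a * q * x k) 0 (i k + vsize j))^-1.

Definition baileyA (N y : vec l) : F :=
  (\prod_k (qseg q (s * x k) 0 (y k) * (qseg q (b * x k) 0 (N k))^-1))
  * kerA N y
  * (qseg q (b / s) 0 (vsize N - vsize y) * qseg q rho 0 (vsize y)
     / qseg q (a * q / s) 0 (vsize N))
  * (b / s) ^+ vsize y.

Definition factorA (j : vec l) : F :=
  (\prod_k (qseg q (b * x k) 0 (j k))^-1) * (\prod_k qseg q (s * x k) 0 (j k))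
  * (qseg q rho 0 (vsize j) / qseg q (a * q / s) 0 (vsize j))
  * (b / s) ^+ vsize j.

Lemma kernel_sum_A (j N : vec l) D : vle j N -> (forall k, N k <= D)%N ->
  qseg q (a * q / s) 0 (vsize j) != 0 -> qseg q (a * q / s) 0 (vsize N) != 0 ->
  \sum_(y : {ffun 'I_l -> 'I_D.+1} | vle j (cube_vec y) && vle (cube_vec y) N)
    baileyA N (cube_vec y) * matA (cube_vec y) j
  = matA N j * factorA j.
Proof.
move=> jN ND sj sN; rewrite /baileyA /matA /factorA.
(* [C] gathers the factors independent of y. *)
pose C := kerA N j * (\prod_k qseg q (s * x k) 0 (j k))
  / (\prod_k qseg q (b * x k) 0 (N k)) / qseg q (a * q / s) 0 (vsize N)
  * (b / s) ^+ vsize j.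
transitivity (C * saal_sum q x b j D (wtA j) N s^-1).
  rewrite /saal_sum big_distrr /=; apply: eq_bigr => y /andP[jy yN].
  set y' := cube_vec y in jy yN *.
  rewrite big_split /= (prod_qseg_nodes s_nz jy) !prodfV /C /wtA.
  have -> : (b / s) ^+ vsize y' = (b / s) ^+ vsize j
      * (b ^+ (vsize y' - vsize j) / s ^+ (vsize y' - vsize j)).
    by rewrite -expr_div_n -exprD subnKC // vle_vsize.
  have sn : s ^+ (vsize y' - vsize j) != 0 by rewrite expf_neq0.
  set p1 := \prod_k _; set p2 := (\prod_k qseg _ (b * _) _ _)^-1.
  set p3 := (\prod_k _)^-1.
  set u := (b / s) ^+ _; set v := s ^+ _ in sn *.
  have vv : v * v^-1 = 1 by rewrite mulfV.
  (* The power of s from [prod_qseg_nodes] cancels the one in (b/s)^|y|; it is displayed as v v^-1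
     so that [ring] applies. *)
  transitivity (p1 * (nodes q x j y' s^-1 * p2) * (kerA N y' * kerA y' j) *
    (qseg q (b / s) 0 (vsize N - vsize y') * qseg q rho 0 (vsize y')
        / qseg q (a * q / s) 0 (vsize N)) * (u * b ^+ (vsize y' - vsize j)) * p3
    * (v * v^-1)).
    by ring.
  by rewrite vv mulr1 kerA_mul //; ring.
rewrite saal_sum_A // /C /valA.
rewrite -(@qseg_cat _ q (a * q / s) 0 (vsize j) (vsize N)) ?vle_vsize // in sN *.
rewrite big_split /=.
have -> : \prod_k qseg q (b * x k) 0 (N k) =
  (\prod_k qseg q (b * x k) 0 (j k)) * (\prod_k qseg q (b * x k) (j k) (N k)).
  rewrite -big_split; apply: eq_bigr => k _ /=.
  by rewrite qseg_cat //= (vleP _ _ jN).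
rewrite !prodfV.
have nz1 : \prod_k qseg q (b * x k) 0 (j k) != 0.
  by rewrite prodf_seq_neq0; apply/allP => k _; apply: qseg_neq0.
have nz2 : \prod_k qseg q (b * x k) (j k) (N k) != 0.
  by rewrite prodf_seq_neq0; apply/allP => k _; apply: qseg_neq0.
set w := (\prod_k qseg q (a * q * x k) _ _)^-1.
have sjN : qseg q (a * q / s) (vsize j) (vsize N) != 0.
  by move: sN; rewrite mulf_eq0 negb_or => /andP[].
move: nz1 nz2 sj sjN; set z1 := \prod_k _; set z2 := \prod_k _.
set z3 := qseg q (a * q / s) _ _; set z4 := qseg q (a * q / s) _ _.
by move=> n1 n2 n3 n4; field; rewrite n1 n2 n3 n4.
Qed.

End TypeA.

(** * The C_l summation *)

Section TypeC.

Variables (F : fieldType) (q : F) (l : nat) (x : 'I_l -> F).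

(** By symmetry a pair (r, k) with r < k may be read as (k, r), so the pairs containing k form a
    single product. This isolates the factors of [pairC] that involve N_k. *)
Lemma prod_lt_pairsD1 (f : 'I_l -> 'I_l -> F) (k : 'I_l) :
  (forall r s, f r s = f s r) ->
  \prod_(r < l) \prod_(s < l | (r < s)%N) f r s =
  (\prod_(s | s != k) f k s)
  * \prod_(r | r != k) \prod_(s < l | (r < s)%N && (s != k)) f r s.
Proof.
move=> fC; rewrite (bigD1 k) //=.
rewrite [X in _ * X = _](eq_bigr (fun r : 'I_l => (if (r < k)%N then f k r else 1) *
    \prod_(s < l | (r < s)%N && (s != k)) f r s)) => [|r rk]; last first.
  rewrite [LHS](bigID (pred1 k)) /=; congr (_ * _).
  rewrite big_mkcondl /= big_pred1_eq; case: ifP => // _; exact: fC.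
rewrite big_split /= mulrA; congr (_ * _).
rewrite [RHS](bigID (fun s : 'I_l => (k < s)%N)) /=; congr (_ * _).
  by apply: eq_bigl => s; case: ltngtP; rewrite ?andbT ?andbF // -val_eqE /=; lia.
rewrite -big_mkcondr /=; apply: eq_bigl => s.
by rewrite -val_eqE /=; lia.
Qed.

Hypothesis q_nz : q != 0.
Hypothesis x_nz : forall k, x k != 0.
Hypothesis x_inj : forall r s m n, x r * q ^+ m = x s * q ^+ n -> r = s /\ m = n.
Hypothesis c_pole : forall r s n, 1 - q * x r * x s * q ^+ n != 0.

Variables (al b : F).
Hypothesis al_nz : al != 0.
Hypothesis b_nz : b != 0.
Hypothesis b_pole : forall k n, 1 - b * x k * q ^+ n != 0.

(** The two denominators of B' indexed by r < s are consecutive segments, from y_r + y_s to y_r +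
    N_s and on to N_r + N_s; [pairC N y] joins them. *)
Definition pairC (i j : vec l) : F :=
  \prod_(r < l) \prod_(s < l | (r < s)%N)
    qseg q (q * x r * x s) (j r + j s) (i r + i s).

Definition squareC (i j : vec l) : F :=
  \prod_r \prod_s qseg q (q * x r * x s) (j r + j s) (i r + j s).

(** The numerator [pairC y j] comes from 1 / pairC N y = pairC y j / pairC N j. *)
Definition wtC (j y : vec l) : F :=
  (\prod_k qseg q (q * x k * b^-1) 0 (y k)) * pairC y j / squareC y j
  / \prod_r nodes q x j y (x r * q ^+ y r).

Definition valC (j N : vec l) (t : F) : F :=
  (\prod_k qseg q (q * x k * b^-1) 0 (j k))
  * (\prod_k qseg q (q * x k * t) (j k) (N k))
  * (\prod_k qseg q (b * x k) (j k) (N k))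
  * pairC N j / squareC N j.

Let c_nz r s m n : qseg q (q * x r * x s) m n != 0.
Proof. exact: qseg_neq0. Qed.

Lemma pairC_neq0 i j : pairC i j != 0.
Proof.
rewrite prodf_seq_neq0; apply/allP => r _ /=; rewrite prodf_seq_neq0.
by apply/allP => s _; apply/implyP.
Qed.

Lemma squareC_neq0 i j : squareC i j != 0.
Proof.
rewrite prodf_seq_neq0; apply/allP => r _ /=; rewrite prodf_seq_neq0.
by apply/allP => s _ /=.
Qed.

Lemma pairC_cat N y j : vle j y -> vle y N -> pairC y j * pairC N y = pairC N j.
Proof.
move=> /vleP jy /vleP yN; rewrite /pairC -big_split; apply: eq_bigr => r _ /=.
rewrite -big_split; apply: eq_bigr => s _ /=.
by rewrite qseg_cat // !leq_add.
Qed.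

(** Extending all segments down to o makes both sides one expression symmetric in m and n. *)
Lemma qseg_swap c o m n J M : (forall i, 1 - c * q ^+ i != 0) ->
  (o <= m + J)%N -> (o <= n + J)%N -> (J <= M)%N ->
  qseg q c (J + m) (M + m) * qseg q c o (n + M) / qseg q c o (n + J) =
  qseg q c (J + n) (M + n) * qseg q c o (m + M) / qseg q c o (m + J).
Proof.
move=> c0 om on JM.
have nz u v : qseg q c u v != 0 by apply: qseg_neq0.
have e u : (o <= u + J)%N ->
    qseg q c (J + u) (M + u) = qseg q c o (u + M) / qseg q c o (u + J).
  move=> ou; rewrite -(@qseg_cat _ q c o (u + J) (u + M)); last by lia.
  by rewrite mulrAC mulfV // mul1r ![(u + _)%N]addnC.
by rewrite (e m) // (e n) //; ring.
Qed.

(** Apart from base b x_k, only the product in t and the factors of [pairC] and of row k of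
    [squareC] that contain N_k change. Each s other than k is an instance of [qseg_swap]. *)
Lemma valC_swap (j N : vec l) k m : vle j N -> (j k <= m < N k)%N ->
  valC j N (x k * q ^+ m) =
  qseg q (b * x k) m (N k) * valC j (upd N k m) (x k * q ^+ N k).
Proof.
move=> jN /andP[jm mN]; rewrite /valC.
have cC r s : q * x r * x s = q * x s * x r by rewrite mulrAC.
have pE (i : vec l) : pairC i j =
    (\prod_(s | s != k) qseg q (q * x k * x s) (j k + j s) (i k + i s))
    * \prod_(r | r != k) \prod_(s < l | (r < s)%N && (s != k))
        qseg q (q * x r * x s) (j r + j s) (i r + i s).
  by rewrite /pairC (prod_lt_pairsD1 k) // => r s; rewrite cC addnC [(i r + _)%N]addnC.
have sE (i : vec l) : squareC i j =
    (qseg q (q * x k * x k) (j k + j k) (i k + j k)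
     * \prod_(s | s != k) qseg q (q * x k * x s) (j k + j s) (i k + j s))
    * \prod_(r | r != k) \prod_s qseg q (q * x r * x s) (j r + j s) (i r + j s).
  by rewrite /squareC (bigD1 k) //= (bigD1 k).
(* At t = x_k q^n the product in t consists of segments of base q x_k x_s, comparable with those of
   [pairC] and [squareC]. *)
have tE (i : vec l) n : \prod_s qseg q (q * x s * (x k * q ^+ n)) (j s) (i s) =
    qseg q (q * x k * x k) (j k + n) (i k + n)
    * \prod_(s | s != k) qseg q (q * x k * x s) (j s + n) (i s + n).
  by rewrite (bigD1 k) //= mulrA qseg_shift; congr (_ * _);
    apply: eq_bigr => s _; rewrite mulrA qseg_shift cC.
rewrite !pE !sE !tE [\prod_s qseg _ (b * _) _ (N _)](bigD1 k) //=.
rewrite [\prod_s qseg _ (b * _) _ (upd _ _ _ _)](bigD1 k) //=.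
rewrite !upd_same -(@qseg_cat _ q (b * x k) (j k) m (N k)); last by lia.
under [\prod_(s | s != k) qseg _ (b * x s) _ (upd _ _ _ _)]eq_bigr => s sk do
  rewrite upd_other //.
under [\prod_(s | s != k) qseg _ _ _ (m + _)]eq_bigr => s sk do
  rewrite upd_other //.
under [\prod_(s | s != k) qseg _ _ _ (upd _ _ _ _ + _)]eq_bigr => s sk do
  rewrite upd_other //.
have -> : \prod_(r | r != k) \prod_(s < l | (r < s)%N && (s != k))
      qseg q (q * x r * x s) (j r + j s) (upd N k m r + upd N k m s)
    = \prod_(r | r != k) \prod_(s < l | (r < s)%N && (s != k))
      qseg q (q * x r * x s) (j r + j s) (N r + N s).
  by apply: eq_bigr => r rk; apply: eq_bigr => s /andP[_ sk]; rewrite !upd_other.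
have -> : \prod_(r | r != k) \prod_s
      qseg q (q * x r * x s) (j r + j s) (upd N k m r + j s)
    = \prod_(r | r != k) \prod_s
      qseg q (q * x r * x s) (j r + j s) (N r + j s).
  by apply: eq_bigr => r rk; rewrite upd_other.
have jkN := vleP _ _ jN.
have : (\prod_(s | s != k) qseg q (q * x k * x s) (j s + m) (N s + m))
   * (\prod_(s | s != k) qseg q (q * x k * x s) (j k + j s) (N k + N s))
   / (\prod_(s | s != k) qseg q (q * x k * x s) (j k + j s) (N k + j s))
   = (\prod_(s | s != k) qseg q (q * x k * x s) (j s + N k) (N s + N k))
   * (\prod_(s | s != k) qseg q (q * x k * x s) (j k + j s) (m + N s))
   / (\prod_(s | s != k) qseg q (q * x k * x s) (j k + j s) (m + j s)).
  rewrite -!prodfV -!big_split; apply: eq_bigr => s _ /=.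
  by apply: qseg_swap; rewrite ?leq_add2r // ltnW // (leq_ltn_trans jm).
(* The diagonal s = k stands apart because [pairC] has no such factor. *)
have : qseg q (q * x k * x k) (j k + m) (N k + m)
       / qseg q (q * x k * x k) (j k + j k) (N k + j k)
     = qseg q (q * x k * x k) (j k + N k) (m + N k)
       / qseg q (q * x k * x k) (j k + j k) (m + j k).
  have nz := c_nz k k; set c := q * x k * x k in nz *.
  have e u w : (j k <= u)%N -> (j k <= w)%N -> qseg q c (j k + u) (w + u) =
      qseg q c (j k + j k) (w + u) / qseg q c (j k + j k) (u + j k).
    move=> ju jw; rewrite [(u + j k)%N]addnC.
    rewrite -(@qseg_cat _ q c (j k + j k) (j k + u) (w + u)); last by lia.
    by rewrite mulrAC mulfV // mul1r.
  by rewrite (e m (N k)) ?(e (N k) m) ?jkN ?(ltnW mN) // [(m + N k)%N]addnC; ring.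
move=> e1 e2; rewrite !invfM.
set u1 := \prod_k _ in e1 e2 *.
set u2 := qseg q (b * _) _ _; set u3 := qseg q (b * _) _ _.
set u4 := \prod_(_ | _) qseg _ (b * _) _ _.
set u6 := (\prod_(_ | _) \prod_(_ | true) _)^-1; set u5 := \prod_(_ | _) \prod_(_ | _) _.
set d1 := (qseg _ _ _ _)^-1 in e1 *; set d1' := (qseg _ _ _ (m + j k))^-1 in e1 *.
set a1 := qseg _ _ _ _ in e1 *; set a1' := qseg _ _ (j k + N k)%N _ in e1 *.
move: e1 e2.
set d2 := (\prod_(_ | _) _)^-1; set d2' := (\prod_(_ | _) qseg _ _ _ (m + _))^-1.
set a2 := (\prod_(_ | _) _); set a2' := (\prod_(_ | _) qseg _ _ (_ + N k) _).
set a3 := (\prod_(_ | _) _); set a3' := (\prod_(_ | _) qseg _ _ _ (m + _)).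
move=> e1 e2.
transitivity (u1 * u2 * u3 * u4 * u5 * u6 * (a1 * d1) * (a2 * a3 * d2)); first by ring.
by rewrite e1 e2; ring.
Qed.

Lemma saal_sum_C (j N : vec l) D t : vle j N -> (forall k, N k <= D)%N ->
  saal_sum q x b j D (wtC j) N t = valC j N t.
Proof.
move=> jN ND; apply: saal_sum_eval => // {N t jN ND} N.
- move=> jN; rewrite vsizeB //.
  apply: polyfun_ext (polyfunZl ((\prod_k qseg q (q * x k * b^-1) 0 (j k))
     * (\prod_k qseg q (b * x k) (j k) (N k)) * pairC N j / squareC N j)
     (polyfun_prod _ _ (fun k => polyfun_qseg q (q * x k) (j k) (N k)))) => t.
  by rewrite /valC; ring.
- move=> jN; rewrite /valC /wtC.
  (* At t = 1/b the segments of base q x_k t continue those of base q x_k / b, which yields the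
     product in [wtC]. *)
  rewrite -[X in X * _ * _ / _ = _]big_split /=.
  under [X in X * _ * _ / _ = _]eq_bigr => k _ do rewrite qseg_cat ?(vleP _ _ jN) //.
  have := nodes_diag_neq0 j x_inj N; set d := \prod_r nodes _ _ _ _ _ => d0.
  by rewrite -[RHS]mulrA [d * _]mulrC divfK //; ring.
by move=> k m jN jm; apply: valC_swap.
Qed.

Definition matC (i j : vec l) : F := kerA q x i j / squareC i j.

Definition baileyC (N y : vec l) : F :=
  (\prod_k ((qseg q (al * x k) 0 (y k) * qseg q (q * x k * b^-1) 0 (y k))
            / (qseg q (b * x k) 0 (N k) * qseg q (q * x k * al^-1) 0 (N k))))
  * kerA q x N y / pairC N y
  * qseg q (b / al) 0 (vsize N - vsize y) * (b / al) ^+ vsize y.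

Definition factorC (j : vec l) : F :=
  (\prod_k ((qseg q (al * x k) 0 (j k) * qseg q (q * x k * b^-1) 0 (j k))
            / (qseg q (b * x k) 0 (j k) * qseg q (q * x k * al^-1) 0 (j k))))
  * (b / al) ^+ vsize j.

Lemma kernel_sum_C (j N : vec l) D : vle j N -> (forall k, N k <= D)%N ->
  (forall k n, qseg q (q * x k * al^-1) 0 n != 0) ->
  \sum_(y : {ffun 'I_l -> 'I_D.+1} | vle j (cube_vec y) && vle (cube_vec y) N)
    baileyC N (cube_vec y) * matC (cube_vec y) j
  = matC N j * factorC j.
Proof.
move=> jN ND al_pole; rewrite /baileyC /matC /factorC.
pose C := kerA q x N j * (\prod_k qseg q (al * x k) 0 (j k))
  / (\prod_k qseg q (b * x k) 0 (N k)) / (\prod_k qseg q (q * x k * al^-1) 0 (N k))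
  / pairC N j * (b / al) ^+ vsize j.
transitivity (C * saal_sum q x b j D (wtC j) N al^-1).
  rewrite /saal_sum big_distrr /=; apply: eq_bigr => y /andP[jy yN].
  set y' := cube_vec y in jy yN *.
  rewrite !big_split /= prodfV big_split /= invfM.
  rewrite (prod_qseg_nodes q x al_nz jy) /C /wtC -(pairC_cat jy yN) invfM.
  have -> : (b / al) ^+ vsize y' = (b / al) ^+ vsize j
      * (b ^+ (vsize y' - vsize j) / al ^+ (vsize y' - vsize j)).
    by rewrite -expr_div_n -exprD subnKC // vle_vsize.
  have sn : al ^+ (vsize y' - vsize j) != 0 by rewrite expf_neq0.
  have p0 := pairC_neq0 y' j.
  set p1 := \prod_k qseg q (al * _) _ _; set p2 := (\prod_k qseg _ (b * _) _ _)^-1.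
  set p3 := (\prod_k _)^-1; set p4 := \prod_k _.
  set u := (b / al) ^+ _; set v := al ^+ _ in sn *.
  have vv : v * v^-1 = 1 by rewrite mulfV.
  have pp : pairC y' j * (pairC y' j)^-1 = 1 by rewrite mulfV.
  transitivity (p1 * nodes q x j y' al^-1 * p2 * p3 * p4
    * (kerA q x N y' * kerA q x y' j) * qseg q (b / al) 0 (vsize N - vsize y')
    * (u * b ^+ (vsize y' - vsize j)) / pairC N y' / squareC y' j * (v * v^-1)); first by ring.
  by rewrite vv kerA_mul // -[LHS]mulr1 -[X in _ * X = _]pp; ring.
rewrite saal_sum_C // /C /valC.
have split (c : 'I_l -> F) : \prod_k qseg q (c k) 0 (N k) =
  (\prod_k qseg q (c k) 0 (j k)) * (\prod_k qseg q (c k) (j k) (N k)).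
  rewrite -big_split; apply: eq_bigr => k _ /=.
  by rewrite qseg_cat //= (vleP _ _ jN).
rewrite !split !big_split /= prodfV big_split /=.
have nz (c : 'I_l -> F) : (forall k n, qseg q (c k) 0 n != 0) ->
    (\prod_k qseg q (c k) 0 (j k) != 0) * (\prod_k qseg q (c k) (j k) (N k) != 0).
  move=> c0; split; rewrite prodf_seq_neq0; apply/allP => k _ //=.
  have := c0 k (N k); rewrite -(@qseg_cat _ q _ 0 (j k) (N k)) ?(vleP _ _ jN) //.
  by rewrite mulf_eq0 negb_or => /andP[].
have [n1 n2] := nz _ al_pole.
have [n3 n4] := nz (fun k => b * x k) (fun k n => qseg_neq0 0 n (b_pole k)).
move: n1 n2 n3 n4 (pairC_neq0 N j) (squareC_neq0 N j) => /=.
set z1 := \prod_k _; set z2 := \prod_k _; set z3 := \prod_k _; set z4 := \prod_k _.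
move=> n1 n2 n3 n4 n5 n6.
by field; rewrite n1 n2 n3 n4 n5 n6.
Qed.

End TypeC.

(** * Transfer to the shifted factorials and denominator conditions of the statement *)

Lemma bailey_pair_ext (F : fieldType) (l : nat) (M M' : vec l -> vec l -> F)
    (A A' B B' : vec l -> F) :
  (forall N j, vle j N -> M N j = M' N j) -> A =1 A' -> B =1 B' ->
  bailey_pair M A B -> bailey_pair M' A' B'.
Proof.
move=> MM AA BB AB N; rewrite -BB AB; apply: eq_bigr => y _.
(* Box sums only see j <= N. Outside this range a [qpoch] of negative index need not agree with an
   empty [qseg]. *)
by rewrite MM ?AA //; apply/vleP => k; rewrite ffunE -ltnS.
Qed.

(** A coincidence of two points would make a factor of some denominator of M vanish; i and j are
    chosen to expose that factor. *)
Lemma denominators_inj (F : fieldType) (q : F) (l : nat) (x : 'I_l -> F) :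
  q != 0 -> (forall k, x k != 0) ->
  (forall i j : vec l, (forall k, (j k <= i k)%N) -> forall r s,
     qpoch q (q * (x r / x s) * q ^ ((j r)%:Z - (j s)%:Z))
             ((i r)%:Z - (j r)%:Z) != 0) ->
  forall r s m n, x r * q ^+ m = x s * q ^+ n -> r = s /\ m = n.
Proof.
move=> q0 x0 den.
have qn n : q ^+ n != 0 by rewrite expf_neq0.
have den1 r s (j : vec l) e : (j r <= e)%N ->
    x s * q ^+ j s != x r * q ^+ e.+1.
  (* This i is large enough for the index e to lie in the segment from j_r to i_r. *)
  pose i : vec l := [ffun k => j k + e.+1]%N.
  have ji k : (j k <= i k)%N by rewrite ffunE leq_addr.
  move=> je; have := den _ _ ji r s; rewrite qpoch_ratio // ffunE.
  rewrite prodf_seq_neq0 => /allP/(_ e); rewrite mem_index_iota je /=.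
  rewrite addnS ltnS leq_addl => /(_ isT); apply: contraNneq => h.
  suff -> : q * (x r / x s) / q ^+ j s * q ^+ e = 1 by rewrite subrr.
  transitivity ((x r * q ^+ e.+1) / (x s * q ^+ j s)).
    by rewrite exprS; field; rewrite x0 qn.
  by rewrite h divff // mulf_neq0.
have eqr r m n : (m < n)%N -> x r * q ^+ m != x r * q ^+ n.
  move=> mn; apply/eqP => h.
  (* Here e + 1 = n - m, so [den1] excludes q^(n - m) = 1. *)
  have := den1 r r [ffun=> 0%N] (n - m.+1)%N; rewrite ffunE leq0n => /(_ isT).
  rewrite expr0 mulr1 -{1}[x r]mulr1 (inj_eq (mulfI (x0 r))) => /eqP; apply.
  apply: (mulfI (qn m)); rewrite -exprD mulr1; have := mulfI (x0 r) h => ->.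
  by congr (_ ^+ _); lia.
move=> r s m n; have [<-|rs] := eqVneq r s.
  move=> h; split=> //; case: (ltngtP m n) => // mn.
    by have /eqP := eqr r _ _ mn.
  by have /eqP := eqr r _ _ mn; rewrite h.
(* [den1] only covers positive exponents at x_r, so the equation is multiplied by q; hence j_s = n +
   1 and e = m. *)
have := den1 r s [ffun k => if k == s then n.+1 else 0%N] m.
rewrite !ffunE eqxx (negPf rs) leq0n => /(_ isT) /eqP ne h; case: ne.
by rewrite !exprSr !mulrA h.
Qed.

Lemma qseg_factor_neq0 (F : fieldType) (q c : F) n :
  qseg q c 0 n.+1 != 0 -> 1 - c * q ^+ n != 0.
Proof. by rewrite /qseg big_nat_recr //= mulf_eq0 negb_or => /andP[]. Qed.

Lemma bailey_lemma_A (F : fieldType) (q : F) (l : nat) (x : 'I_l.+1 -> F)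
    (a rho sigma : F) (A B : vec l.+1 -> F) :
  q != 0 -> rho != 0 -> sigma != 0 ->
  denominators_A q a rho sigma x ->
  bailey_pair (M_A q a x) A B ->
  bailey_pair (M_A q a x) (A'_A q a rho sigma x A) (B'_A q a rho sigma x B).
Proof.
move=> q0 rho0 s0 [x0 den_x den_a den_b den_s] AB.
have x_inj := denominators_inj q0 x0 den_x.
set xm := x ord_max; have xm0 : xm != 0 := x0 _.
(* Absorbing x_l in the parameters turns x_k / x_l into x_k. *)
pose a1 := a / xm; pose s1 := sigma / xm; pose b1 := a * q / rho / xm.
have aE k : a1 * q * x k = a * q * (x k / xm) by rewrite /a1; ring.
have bE k : b1 * x k = a * q / rho * (x k / xm) by rewrite /b1; ring.
have sE k : s1 * x k = sigma * (x k / xm) by rewrite /s1; ring.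
have asE : a1 * q / s1 = a * q / sigma by rewrite /a1 /s1; field; rewrite s0 xm0.
have bsE : b1 / s1 = a * q / (rho * sigma).
  by rewrite /b1 /s1; field; rewrite s0 xm0 rho0.
(* For i constantly n + 1 and j = 0, the last factor of the denominator is the required one. *)
have a_pole k n : 1 - a1 * q * x k * q ^+ n != 0.
  apply: qseg_factor_neq0; rewrite aE.
  have := den_a [ffun=> n.+1] [ffun=> 0%N] _ k.
  rewrite ffunE /vsize big1 ?addn0 => [|i _]; last by rewrite ffunE.
  by apply=> i; rewrite !ffunE.
have b_pole k n : 1 - b1 * x k * q ^+ n != 0.
  by apply: qseg_factor_neq0; rewrite bE; have := den_b [ffun=> n.+1] k; rewrite ffunE.
have as0 (N : vec l.+1) : qseg q (a1 * q / s1) 0 (vsize N) != 0.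
  by rewrite asE; exact: (den_s N).
have s10 : s1 != 0 by rewrite mulf_neq0 ?invr_neq0.
have a1b1 : a1 * q = b1 * rho by rewrite /a1 /b1; field; rewrite xm0 rho0.
have ME N j : matA q x a1 N j = M_A q a x N j.
  by congr (_ * _); apply: eq_bigr => k _; rewrite aE.
have AB1 : bailey_pair (matA q x a1) A B.
  by apply: bailey_pair_ext AB => // N j _; rewrite ME.
have := bailey_pair_lift (K := baileyA q x a1 s1 rho b1)
  (c := factorA q x a1 s1 rho b1) _ AB1.
move=> /(_ (fun N j jN => kernel_sum_A q0 x0 x_inj a1b1 s10 a_pole b_pole jN
  (leq_vsize N) (as0 j) (as0 N))).
apply: bailey_pair_ext => [N j _|N|N]; first exact: ME.
  rewrite /factorA /A'_A asE bsE; congr (_ * _ * _ * _ * _).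
    by apply: eq_bigr => k _; rewrite bE.
  by apply: eq_bigr => k _; rewrite sE.
apply: eq_bigr => y _; congr (_ * _).
have yN : vle (box_vec y) N by apply/vleP => k; rewrite ffunE -ltnS.
rewrite /baileyA asE bsE subzn ?vle_vsize //; congr (_ * _ * _ * _).
by apply: eq_bigr => k _; rewrite sE bE.
Qed.

Lemma qpoch_shift (F : fieldType) (q c : F) k v n : (v <= n)%N ->
  qpoch q (c * q ^+ k) (n%:Z - v%:Z) = qseg q c k (k + (n - v)).
Proof.
move=> vn; rewrite subzn // -[LHS]/(qseg q _ 0 _) qseg_shift add0n.
by rewrite addnC.
Qed.

Lemma bailey_lemma_C (F : fieldType) (q : F) (l : nat) (x : 'I_l -> F)
    (alpha beta : F) (A B : vec l -> F) :
  q != 0 -> alpha != 0 -> beta != 0 ->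
  denominators_C q alpha beta x ->
  bailey_pair (M_C q x) A B ->
  bailey_pair (M_C q x) (A'_C q alpha beta x A) (B'_C q alpha beta x B).
Proof.
move=> q0 al0 b0 [x0 den_x den_c den_b den_al] AB.
have x_inj := denominators_inj q0 x0 den_x.
have c_pole r s n : 1 - q * x r * x s * q ^+ n != 0.
  apply: qseg_factor_neq0.
  have := den_c [ffun=> n.+1] [ffun=> 0%N] _ r s.
  rewrite !ffunE expr0 mulr1 subr0; apply=> i.
  by rewrite !ffunE.
have b_pole k n : 1 - beta * x k * q ^+ n != 0.
  by apply: qseg_factor_neq0; have := den_b [ffun=> n.+1] k; rewrite ffunE.
have al_pole k n : qseg q (q * x k * alpha^-1) 0 n != 0.
  by have := den_al [ffun=> n] k; rewrite ffunE.
have ME N j : vle j N -> matC q x N j = M_C q x N j.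
  move=> /vleP jN; rewrite /matC /kerA /squareC -prodfV -big_split.
  apply: eq_bigr => r _ /=; rewrite -prodfV -big_split; apply: eq_bigr => s _ /=.
  rewrite qpoch_shift //; congr (_ * (qseg _ _ _ _)^-1).
  by rewrite addnAC subnKC.
have AB1 : bailey_pair (matC q x) A B.
  by apply: bailey_pair_ext AB => // N j jN; rewrite ME.
have := bailey_pair_lift (K := baileyC q x alpha beta)
  (c := factorC q x alpha beta) _ AB1.
move=> /(_ (fun N j jN => kernel_sum_C q0 x0 x_inj c_pole al0 b0 b_pole jN
  (leq_vsize N) al_pole)).
apply: bailey_pair_ext => [N j jN|N|N //]; [exact: ME | by [] |].
apply: eq_bigr => y _; congr (_ * _).
have yN : vle (box_vec y) N by apply/vleP => k; rewrite ffunE -ltnS.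
rewrite /baileyC subzn ?vle_vsize //; congr (_ * _ * _ * _).
rewrite /pairC -prodfV; apply: eq_bigr => r _.
rewrite -prodfV; apply: eq_bigr => s _.
set y' := box_vec y in yN *; move/vleP in yN.
rewrite !qpoch_shift // -invfM; congr (_^-1).
rewrite -(@qseg_cat _ _ _ (y' r + y' s) (y' r + N s) (N r + N s)); last first.
  by rewrite leq_add2l leq_add2r !yN.
have e1 : (y' r + y' s + (N s - y' s) = y' r + N s)%N by rewrite -addnA subnKC.
have e2 : (N s + y' r + (N r - y' r) = N r + N s)%N by rewrite -addnA subnKC // addnC.
by rewrite e1 e2 [(N s + _)%N]addnC.
Qed.

(* The indeterminates and parameters live in an arbitrary extension F of the
   complex numbers, such as R[i] itself (numerical values) or a field of
   rational functions over R[i] (formal indeterminates). The rank is l.+1. *)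
Theorem mainTheorem2 (R : realType) (q0 : R[i])
    (q0_gt0 : 0 < `|q0|) (q0_lt1 : `|q0| < 1)
    (F : fieldType) (iota : {rmorphism R[i] -> F})
    (l : nat) (x : 'I_l.+1 -> F) :
  let q := iota q0 in
  (forall (a rho sigma : F) (A B : vec l.+1 -> F),
     rho != 0 -> sigma != 0 ->
     denominators_A q a rho sigma x ->
     bailey_pair (M_A q a x) A B ->
     bailey_pair (M_A q a x) (A'_A q a rho sigma x A)
                             (B'_A q a rho sigma x B))
  /\
  (forall (alpha beta : F) (A B : vec l.+1 -> F),
     alpha != 0 -> beta != 0 ->
     denominators_C q alpha beta x ->
     bailey_pair (M_C q x) A B ->
     bailey_pair (M_C q x) (A'_C q alpha beta x A)
                           (B'_C q alpha beta x B)).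
Proof.
move=> q; have q_nz : q != 0 by rewrite fmorph_eq0 -normr_gt0.
split=> [a rho sigma|alpha beta] A B.
  exact: bailey_lemma_A.
exact: bailey_lemma_C.
Qed.
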